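(* Suppose that $\kappa < \mu$ are infinite cardinals such that $\mathrm{cf}(\mu) < \kappa$ and there does not exist a strongly unbounded subadditive coloring $c:(\mathscr{P}_\kappa \mu^+)^{[2]} \rightarrow \mathrm{cf}(\mu)$. Then $\mathsf{CP}(\mathcal D)$ holds for every uniform, transitive $\mathrm{cf}(\mu)$-covering matrix $\mathcal D$ for $\mu^+$.
   Context: $\mathscr{P}_\kappa X = \{x \subseteq X \mid |x|<\kappa\}$, viewed as a partial order under $\subsetneq$; $(\mathscr{P}_\kappa X)^{[2]}$ is the set of pairs $(x,y)$ of elements of $\mathscr{P}_\kappa X$ with $x \subsetneq y$. For a partial order $\Lambda$ and $\Lambda^{[2]}$ its set of pairs $(u,v)$ with $u<_\Lambda v$, a function $c:\Lambda^{[2]} \to \theta$ is subadditive if for all $u <_\Lambda v <_\Lambda w$: $c(u,w) \leq \max\{c(u,v), c(v,w)\}$ and $c(u,v) \leq \max\{c(u,w), c(v,w)\}$; strongly unbounded if for every cofinal $\Gamma \subseteq \Lambda$, $c``\Gamma^{[2]}$ is unbounded in $\theta$. For regular cardinals $\theta < \lambda$, a $\theta$-covering matrix for $\lambda$ is $\mathcal D = \langle D(i,\beta) \mid i < \theta, \beta < \lambda\rangle$ such that (1) for each $\beta<\lambda$, $\langle D(i,\beta) \mid i < \theta\rangle$ is $\subseteq$-increasing with union $\beta$; (2) for all $\beta < \gamma < \lambda$ and $i < \theta$ there is $j < \theta$ with $D(i,\beta) \subseteq D(j,\gamma)$. $\mathcal D$ is transitive if for all $\beta < \gamma<\lambda$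 and $i<\theta$, $\beta \in D(i,\gamma)$ implies $D(i,\beta) \subseteq D(i,\gamma)$; uniform if for every limit $\beta < \lambda$ there is $i<\theta$ such that $D(i,\beta)$ contains a club in $\beta$. $\mathsf{CP}(\mathcal D)$ holds if there is an unbounded $A \subseteq \lambda$ such that for every $X \in [A]^\theta$ there are $\beta<\lambda$ and $i<\theta$ with $X \subseteq D(i,\beta)$. *)

(* Defs.v *)
From HB Require Import structures.
From mathcomp Require Import all_boot all_order.
From mathcomp Require Import boolp classical_sets functions cardinality.

Set Implicit Arguments.
Unset Strict Implicit.
Unset Printing Implicit Defensive.

Import Order.TTheory.
Local Open Scope classical_set_scope.
Local Open Scope order_scope.
Local Open Scope card_scope.

Reserved Notation "A '#<' B" (at level 79, format "A  '#<'  B").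

Definition card_lt T U (A : set T) (B : set U) : bool :=
  (A #<= B) && ~~ (A #= B).
Notation "A '#<' B" := (card_lt A B) : card_scope.

(* In a limit ordinal, being cofinal is the same as being unbounded. *)
Definition cofinal d (P : porderType d) (A : set P) : Prop :=
  forall x, exists2 y, A y & x <= y.

(* An ordinal is represented by a well-ordered type: its elements are the
   smaller ordinals, and the element b is, as a set, [set a | a < b]. *)
Definition is_ordinal d (T : orderType d) : Prop :=
  well_founded (fun x y : T => x < y).

(* Cardinals are initial ordinals. *)
Definition is_cardinal d (T : orderType d) : Prop :=
  is_ordinal T /\ forall b : T, [set a | a < b] #< [set: T].

Definition is_infinite_cardinal d (T : orderType d) : Prop :=
  is_cardinal T /\ infinite_set [set: T].

(* L = M^+ *)
Definition is_successor_cardinal dL (L : orderType dL) dM (M : orderType dM) :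
    Prop :=
  [/\ is_cardinal L, [set: M] #< [set: L] &
      forall (U : Type) (B : set U), [set: M] #< B -> [set: L] #<= B].

(* T = cf(M), the least cardinality of a cofinal subset of M *)
Definition is_cofinality dT (T : orderType dT) dM (M : orderType dM) : Prop :=
  [/\ is_cardinal T,
      exists2 A : set M, cofinal A & A #= [set: T] &
      forall A : set M, cofinal A -> [set: T] #<= A].

Section Colorings.
Context d (P : porderType d) dT (T : orderType dT).

Definition pairs : Type := {p : P * P | p.1 < p.2}.

Definition mkpair (u v : P) (uv : u < v) : pairs := exist _ (u, v) uv.

Definition subadditive (c : pairs -> T) : Prop :=
  forall (u v w : P) (uv : u < v) (vw : v < w) (uw : u < w),
    c (mkpair uw) <= Order.max (c (mkpair uv)) (c (mkpair vw)) /\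
    c (mkpair uv) <= Order.max (c (mkpair uw)) (c (mkpair vw)).

Definition strongly_unbounded (c : pairs -> T) : Prop :=
  forall G : set P, cofinal G ->
    cofinal (c @` [set p | G (val p).1 /\ G (val p).2]).

End Colorings.

(* The order is inherited from set X, hence < is strict inclusion, see
   lt_PkappaE. *)
Definition Pkappa (K X : Type) : Type :=
  {x : set X | x \in [set y : set X | y #< [set: K]]}.

HB.instance Definition _ (K X : Type) := SubChoice.on (Pkappa K X).
HB.instance Definition _ (K X : Type) :=
  [SubChoice_isSubPOrder of Pkappa K X by <: with set_display].

Lemma lt_PkappaE (K X : Type) (x y : Pkappa K X) :
  (x < y) = (val x `<` val y) :> Prop.
Proof. by rewrite -properEset. Qed.

Section Clubs.
Context d (L : orderType d).

Definition is_limit (b : L) : Prop :=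
  (exists a, a < b) /\ forall a, a < b -> exists2 g, a < g & g < b.

Definition unbounded_below (C : set L) (b : L) : Prop :=
  forall a, a < b -> exists2 g, C g & a <= g /\ g < b.

Definition club_in (C : set L) (b : L) : Prop :=
  [/\ C `<=` [set a | a < b],
      unbounded_below C b &
      forall a, a < b -> is_limit a -> unbounded_below C a -> C a].

End Clubs.

Section CoveringMatrices.
Context dT (T : orderType dT) dL (L : orderType dL).
Implicit Type D : T -> L -> set L.

Definition covering_matrix D : Prop :=
  [/\ forall b i j, i <= j -> D i b `<=` D j b,
      forall b, \bigcup_i D i b = [set a | a < b] &
      forall b g i, b < g -> exists j, D i b `<=` D j g].

Definition transitive_matrix D : Prop :=
  forall b g i, b < g -> D i g b -> D i b `<=` D i g.

Definition uniform_matrix D : Prop :=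
  forall b, is_limit b ->
    exists i, exists2 C : set L, club_in C b & C `<=` D i b.

Definition CP D : Prop :=
  exists2 A : set L, cofinal A &
    forall X : set L, X `<=` A -> X #= [set: T] ->
      exists b i, X `<=` D i b.

End CoveringMatrices.

(* Main.v *)
Require Import Defs.
From HB Require Import structures.
From mathcomp Require Import all_boot all_order.
From mathcomp Require Import boolp wochoice classical_sets functions.
From mathcomp Require Import cardinality.

(**
  Write F_b(j) = D(j, b) `&` x for x in P_kappa(mu^+). By transitivity F_b is
  included in F_g for b < g at all large j. If for every x this sequence
  stabilizes modulo bounded, say from b_x on, then the least i such that F_{b_x}
  and F_{b_y} agree on x at all j >= i is a subadditive coloring c(x, y); a
  cofinal family on which c is bounded by some i glues the functions sending
  a \in x to some j >= i with a \in D(j, b_x) into one function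
  mu^+ -> cf(mu), and an unbounded set on which this function is bounded
  witnesses CP(D).

  Stabilization is an argument of Shelah, with uniformity as its key input.
  Since mu is a limit cardinal, N = kappa^+, I = kappa^{++} and R = kappa^{+3}
  lie below mu. If some sequence of traces did not stabilize, build a strictly
  growing R-sequence of traces that, for every initial segment of every member
  of a club-guessing family of N-sequences in R, anticipates an upper bound
  whenever one exists. At the supremum b a club lies in a single D(i, b), so a
  guessed N-sequence inside that club consists of traces included in F_b from i
  on; its unions have to stop growing because N is larger than x and cf(mu), a
  contradiction.
*)

Set Implicit Arguments.
Unset Strict Implicit.
Unset Printing Implicit Defensive.

Import Order.TTheory.
Local Open Scope order_scope.
Local Open Scope classical_set_scope.
Local Open Scope card_scope.

(** * Ordinals, well-orderings and recursion *)

Lemma ordinal_least d (W : orderType d) (A : set W) :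
  is_ordinal W -> A !=set0 -> exists2 m, A m & forall a, A a -> m <= a.
Proof.
move=> W_ord [a]; elim/(well_founded_ind W_ord): a => a IH Aa.
have [[b [ba Ab]]|nb] := pselect (exists b, b < a /\ A b); first exact: IH Ab.
by exists a => // b Ab; rewrite leNgt; apply/negP => ba; apply: nb; exists b.
Qed.

Lemma nonincreasing_ordinal_stationary dI (I : orderType dI) d (W : orderType d)
    (f : I -> W) (i0 : I) :
  is_ordinal W -> {homo f : i k / i <= k >-> k <= i} ->
  exists i, forall k, i <= k -> f k = f i.
Proof.
move=> W_ord f_anti.
have [_ [i _ <-] f_min] :=
  ordinal_least W_ord (ex_intro (range f) _ (imageT f i0)).
by exists i => k ik; apply/eqP; rewrite eq_le f_anti //= f_min //; exists k.
Qed.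

Lemma wf_choice_recursion (I V : Type) (v0 : V) (R : I -> I -> Prop)
    (P : I -> (I -> V) -> V -> Prop) :
  well_founded R ->
  (forall s f g v, (forall t, R t s -> f t = g t) -> P s f v -> P s g v) ->
  (forall s f, (forall t, R t s -> P t f (f t)) -> exists v, P s f v) ->
  exists f, forall s, P s f (f s).
Proof.
elim/Pchoice: V => V in v0 P *; move=> R_wf P_local P_ex.
pose extend s (g : forall t, R t s -> V) t :=
  if pselect (R t s) is left ts then g t ts else v0.
pose step s g := xget v0 (P s (extend s g)).
pose f := Fix R_wf (fun _ => V) step.
have fE s : f s = step s (fun t _ => f t).
  rewrite /f Fix_eq // => t g h gh; congr step.
  by do 2!apply: functional_extensionality_dep => ?.
exists f => s; elim/(well_founded_ind R_wf): s => s IH.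
have extendE t : R t s -> f t = extend s (fun t _ => f t) t.
  by rewrite /extend; case: pselect.
apply: (P_local _ (extend s (fun t _ => f t))) => [t /extendE //|].
rewrite fE; apply: xgetPex.
by have [v Pv] := P_ex s f IH; exists v; apply: P_local Pv.
Qed.

Section WellOrder.
Variables (T : choiceType) (R : rel T) (woR : well_order R).

Let wo_chainT : wo_chain R T := withinW woR.

Lemma well_order_refl : reflexive R.
Proof. exact: in1T (wo_chain_reflexive wo_chainT). Qed.

Lemma well_order_anti : antisymmetric R.
Proof. exact: in2T (wo_chain_antisymmetric wo_chainT). Qed.

Lemma well_order_total : total R.
Proof. exact: in2T (wo_chainW wo_chainT). Qed.

Lemma well_order_trans : transitive R.
Proof.
move=> y x z Rxy Ryz.
have /woR[m [[m_in m_lb] _]] : wochoice.nonempty [in [:: x; y; z]].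
  by exists x; rewrite !inE eqxx.
have Rm t : t \in [:: x; y; z] -> R m t by exact: m_lb.
case/or4P: m_in => // /eqP mE; subst m.
- by apply: Rm; rewrite !inE eqxx !orbT.
- suff -> : x = y by [].
  by apply: well_order_anti; rewrite Rxy Rm // inE eqxx.
- suff <- : y = z by [].
  by apply: well_order_anti; rewrite Ryz Rm // !inE eqxx !orbT.
Qed.

Definition well_ordered (_ : well_order R) : Type := T.

HB.instance Definition _ := Choice.on (well_ordered woR).
HB.instance Definition _ := Order.Le_isPOrder.Build (Order.Disp tt tt)
  (well_ordered woR) well_order_refl well_order_anti well_order_trans.
HB.instance Definition _ := Order.POrder_isTotal.Build (Order.Disp tt tt)
  (well_ordered woR) well_order_total.

Lemma well_ordered_ordinal : is_ordinal (well_ordered woR).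
Proof.
move=> x; apply: contrapT => nAx.
pose A := [pred y | `[< ~ Acc (fun a b : well_ordered woR => a < b) y >]].
have /woR[m [[/asboolP nAm m_le] _]] : wochoice.nonempty A.
  by exists x; exact/asboolP.
apply: nAm; constructor=> y ym; apply: contrapT => nAy.
have : (m : well_ordered woR) <= y by apply: m_le; exact/asboolP.
by rewrite leNgt ym.
Qed.

End WellOrder.

Lemma card_eq_ordinal T (A : set T) :
  exists d (W : orderType d), is_ordinal W /\ A #= [set: W].
Proof.
have ex (U : choiceType) :
    exists d (W : orderType d), is_ordinal W /\ [set: U] #= [set: W].
  have [R woR] := well_ordering_principle U.
  exists (Order.Disp tt tt), (well_ordered woR).
  by split; [exact: well_ordered_ordinal|exact: card_eqxx].
elim/Pchoice: T => T in A *; have [d [W [W_ord AW]]] := ex (set_type A).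
by exists d, W; split=> //; exact: card_eq_trans (card_setT_sym A) AW.
Qed.

(** * Cardinal arithmetic *)

Lemma card_le_inj T U (A : set T) (B : set U) (f : T -> U) :
  set_fun A B f -> set_inj A f -> A #<= B.
Proof.
move=> fAB f_inj; rewrite -(card_le_eql (inj_card_eq f_inj)).
by apply: subset_card_le => _ [a Aa <-]; exact: fAB.
Qed.

Lemma card_le_initial_segments T (R : T -> T -> Prop) (S : set T)
    U (B : set U) :
  well_founded R ->
  (forall a b, S a -> S b -> a <> b -> R a b \/ R b a) ->
  (forall b, S b -> ~ (B #<= [set a | S a /\ R a b])) ->
  S #<= B.
Proof.
move=> R_wf totR small.
have [[s0 Ss0]|S0] := pselect (S !=set0); last first.
  suff -> : S = set0 by exact: card_ge0.
  by apply/seteqP; split=> // a Sa; apply: S0; exists a.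
have [u0 _] : B !=set0.
  apply: contrapT => B0; apply: (small s0 Ss0).
  suff -> : B = set0 by exact: card_ge0.
  by apply/seteqP; split=> // a Ba; apply: B0; exists a.
pose fresh s (f : T -> U) v := B v /\ forall t, S t -> R t s -> f t <> v.
have [f fP] : exists f, forall s, S s -> fresh s f (f s).
  apply: (wf_choice_recursion (P := fun s f v => S s -> fresh s f v) u0 R_wf).
    move=> s f g v fg fresh_v /fresh_v[Bv fv]; split=> // t St ts.
    by rewrite -fg //; exact: fv.
  move=> s f _; have [Ss|nSs] := pselect (S s); last by exists u0.
  apply: contrapT => no_fresh; apply: (small s Ss).
  apply: card_le_trans (card_image_le f _); apply: subset_card_le => v Bv.
  apply: contrapT => nfv; apply: no_fresh; exists v => _; split=> // t St ts ft.
  by apply: nfv; exists t.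
apply: (@card_le_inj _ _ _ _ f) => [a /fP[]//|a b]; rewrite !inE => Sa Sb fab.
apply: contrapT => /(totR _ _ Sa Sb) [ab|ba].
  by have [_ /(_ a Sa ab)] := fP b Sb.
by have [_ /(_ b Sb ba)] := fP a Sa; rewrite fab.
Qed.

Lemma ordinal_card_le d (W : orderType d) U (B : set U) :
  is_ordinal W -> (forall w : W, ~ (B #<= [set a | a < w])) -> [set: W] #<= B.
Proof.
move=> W_ord small.
apply: (card_le_initial_segments W_ord) => [a b _ _ /eqP|b _ Bb].
  by rewrite neq_lt => /orP[]; [left|right].
apply: (small b); apply: card_le_trans Bb _.
by apply: subset_card_le => a [].
Qed.

Lemma card_le_total T U (A : set T) (B : set U) : A #<= B \/ B #<= A.
Proof.
have [d [W [W_ord AW]]] := card_eq_ordinal A.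
have [BA|nBA] := pselect (B #<= A); [by right|left].
rewrite (card_le_eql AW); apply: ordinal_card_le => // b Bb; apply: nBA.
by rewrite (card_le_eqr AW); exact: card_le_trans Bb (card_leT _).
Qed.

Lemma card_ltNge T U (A : set T) (B : set U) : (A #< B) = ~~ (B #<= A).
Proof.
rewrite /card_lt card_eq_le negb_and andb_orr andbN /= andbC.
by case: (boolP (B #<= A)) => //= nBA; case: (card_le_total A B) nBA => // ->.
Qed.

Lemma card_leNgt T U (A : set T) (B : set U) : (A #<= B) = ~~ (B #< A).
Proof. by rewrite card_ltNge negbK. Qed.

Lemma card_ltW T U (A : set T) (B : set U) : A #< B -> A #<= B.
Proof. by case/andP. Qed.

Lemma card_le_lt_trans T U V (B : set U) (A : set T) (C : set V) :
  A #<= B -> B #< C -> A #< C.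
Proof.
by move=> AB; rewrite !card_ltNge; apply: contra => /card_le_trans; exact.
Qed.

Lemma card_le_infinite T U (A : set T) (B : set U) :
  infinite_set A -> A #<= B -> infinite_set B.
Proof.
by move=> A_inf AB B_fin; apply: A_inf; exact: card_le_finite AB B_fin.
Qed.

Lemma finite_lt_infinite T U (A : set T) (B : set U) :
  finite_set A -> infinite_set B -> A #< B.
Proof.
move=> A_fin B_inf; rewrite card_ltNge; apply/negP => BA.
exact: (card_le_infinite B_inf BA).
Qed.

Lemma card_bigcup_le_setX I T U V (J : set I) (F : I -> set T) (X : set U)
    (Y : set V) :
  J #<= X -> (forall i, J i -> F i #<= Y) -> \bigcup_(i in J) F i #<= X `*` Y.
Proof.
elim/Ppointed: U => U in X *.
  by rewrite !emptyE => -> _; rewrite bigcup_set0.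
elim/Ppointed: V => V in Y *.
  rewrite !emptyE => _ F0; rewrite bigcup0 // => i Ji; exact/card_le0P/F0.
elim/Ppointed: I => I in J F *.
  by rewrite !emptyE bigcup_set0 => _ _; exact: card_ge0.
move=> /pcard_leP/injfunPex[f fJX f_inj] FY.
have /choice[g gP] : forall i, exists g : T -> V,
    J i -> set_fun (F i) Y g /\ set_inj (F i) g.
  move=> i; have [Ji|nJi] := pselect (J i); last by exists (fun=> point).
  by have /pcard_leP/injfunPex[g gFY g_inj] := FY i Ji; exists g.
pose idx t := get [set i | J i /\ F i t].
have idxP t : (\bigcup_(i in J) F i) t -> J (idx t) /\ F (idx t) t.
  by move=> [i Ji Fi]; apply: (getPex (P := [set i | J i /\ F i t])); exists i.
apply: (@card_le_inj _ _ _ _ (fun t => (f (idx t), g (idx t) t))).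
  by move=> t /idxP[Ji Fi]; split; [exact: fJX|exact: (gP _ Ji).1].
move=> s t; rewrite !inE => /idxP[Js Fs] /idxP[Jt Ft] [fst].
have idx_st : idx s = idx t by apply: f_inj; rewrite ?inE.
by rewrite idx_st => /(gP _ Jt).2; apply; rewrite inE // -idx_st.
Qed.

Lemma card_setX_le T T' U U' (A : set T) (A' : set T') (B : set U)
    (B' : set U') :
  A #<= B -> A' #<= B' -> A `*` A' #<= B `*` B'.
Proof.
move=> AB A'B'; have -> : A `*` A' = \bigcup_(a in A) (pair a @` A').
  apply/seteqP; split=> [[a a'] [/= Aa Aa']|_ [a Aa [a' Aa' <-]]] //.
  by exists a => //; exists a'.
apply: card_bigcup_le_setX => // a _.
exact: card_le_trans (card_image_le _ _) A'B'.
Qed.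

Lemma card_setU_le_setX T U (A B : set T) (X : set U) :
  infinite_set X -> A #<= X -> B #<= X -> A `|` B #<= X `*` X.
Proof.
move=> /infiniteP natX AX BX; rewrite -bigcup2E.
apply: card_bigcup_le_setX => // -[|[|n]] _ //=; exact: card_ge0.
Qed.

Section Goedel.
Context d (W : orderType d).
Implicit Types p q : W * W.

Definition goedel_lt p q : Prop :=
  let max_of (r : W * W) := Order.max r.1 r.2 in
  max_of p < max_of q \/
  max_of p = max_of q /\ (p.1 < q.1 \/ p.1 = q.1 /\ p.2 < q.2).

Lemma goedel_lt_wf : is_ordinal W -> well_founded goedel_lt.
Proof.
move=> W_ord [a b]; move: {2}(Order.max _ _) (erefl (Order.max a b)) => m.
elim/(well_founded_ind W_ord): m a b => m IHm a.
elim/(well_founded_ind W_ord): a => a IHa b.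
elim/(well_founded_ind W_ord): b => b IHb mE.
constructor=> -[a' b'] [/= max_lt|[/= max_eq [a_lt|[a_eq b_lt]]]].
- by apply: (IHm (Order.max a' b')) => //; rewrite -mE.
- by apply: IHa => //; rewrite max_eq.
- by subst a'; apply: IHb => //; rewrite max_eq.
Qed.

Lemma goedel_lt_total p q : p <> q -> goedel_lt p q \/ goedel_lt q p.
Proof.
case: p q => [a b] [a' b'] ne; rewrite /goedel_lt /=.
case: (ltgtP (Order.max a b) (Order.max a' b')) => [||max_eq];
  [by left; left|by right; left|].
case: (ltgtP a a') => [a_lt|a_gt|a_eq];
  [by left; right; auto|by right; right; auto|].
case: (ltgtP b b') => [b_lt|b_gt|b_eq];
  [by left; right; auto|by right; right; auto|].
by case: ne; rewrite a_eq b_eq.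
Qed.

Lemma card_setX_downset (S : set W) : is_ordinal W ->
  (forall a b, S b -> a < b -> S a) ->
  (forall a, S a -> infinite_set [set b | b < a] ->
     [set b | b < a] `*` [set b | b < a] #<= [set b | b < a]) ->
  infinite_set S -> S `*` S #<= S.
Proof.
move=> W_ord downS square_lt S_inf.
have [[a [Sa Sle]]|S_initial] :=
  pselect (exists a, S a /\ S #<= [set b | b < a]).
  apply: card_le_trans (card_setX_le Sle Sle) _.
  apply: card_le_trans (square_lt a Sa (card_le_infinite S_inf Sle)) _.
  by apply: subset_card_le => b; exact: downS.
apply: (card_le_initial_segments (goedel_lt_wf W_ord)).
  by move=> p q _ _; exact: goedel_lt_total.
move=> [p q] [/= Sp Sq]; set m := Order.max p q => Sle.
have Sm : S m by rewrite /m; case: (leP p q).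
pose M := [set b | b <= m].
have {}Sle : S #<= M `*` M.
  apply: card_le_trans Sle _; apply: subset_card_le => -[a b] [_ lt] /=.
  have : Order.max a b <= m by case: lt => /= [/ltW|[-> _]].
  by rewrite ge_max => /andP[].
have ME : M = [set b | b < m] `|` [set m].
  apply/seteqP; split=> b; rewrite /M /= le_eqVlt.
    by move=> /orP[/eqP|]; [right|left].
  by move=> [->|->]; rewrite ?eqxx ?orbT.
have [fin|inf] := pselect (finite_set [set b | b < m]).
  apply: S_inf; apply: card_le_finite Sle _; apply: finite_setX;
  by rewrite ME finite_setU; split=> //; exact: finite_set1.
apply: S_initial; exists m; split=> //; apply: card_le_trans Sle _.
suff Mle : M #<= [set b | b < m].
  exact: card_le_trans (card_setX_le Mle Mle) (square_lt m Sm inf).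
rewrite ME; apply: card_le_trans (square_lt m Sm inf).
apply: (card_setU_le_setX inf (card_lexx _)).
exact/card_ltW/(finite_lt_infinite (finite_set1 m) inf).
Qed.

End Goedel.

Lemma card_setX_infinite T (A : set T) : infinite_set A -> A `*` A #<= A.
Proof.
move=> A_inf; have [d [W [W_ord AW]]] := card_eq_ordinal A.
have [AleW WleA] : A #<= [set: W] /\ [set: W] #<= A.
  by apply/andP; rewrite -card_eq_le.
suff square : [set: W] `*` [set: W] #<= [set: W].
  apply: card_le_trans (card_setX_le AleW AleW) _.
  exact: card_le_trans square WleA.
apply: card_setX_downset (card_le_infinite A_inf AleW) => // a _.
elim/(well_founded_ind W_ord): a => a IH.
by apply: card_setX_downset => // b c /= ca bc; exact: lt_trans ca.
Qed.

Lemma card_bigcup_le I T U (J : set I) (F : I -> set T) (X : set U) :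
  infinite_set X -> J #<= X -> (forall i, J i -> F i #<= X) ->
  \bigcup_(i in J) F i #<= X.
Proof.
move=> X_inf JX FX; apply: card_le_trans (card_setX_infinite X_inf).
exact: card_bigcup_le_setX.
Qed.

Lemma card_setU_le T U (A B : set T) (X : set U) :
  infinite_set X -> A #<= X -> B #<= X -> A `|` B #<= X.
Proof.
move=> X_inf AX BX; apply: card_le_trans (card_setX_infinite X_inf).
exact: card_setU_le_setX.
Qed.

Lemma card_lt_setU T U (A B : set T) (X : set U) :
  infinite_set X -> A #< X -> B #< X -> A `|` B #< X.
Proof.
move=> X_inf; wlog AB : A B / A #<= B.
  move=> wlogAB AX BX; have [AB|BA] := card_le_total A B; first exact: wlogAB.
  by rewrite setUC; exact: wlogAB.
move=> AX BX; have [B_fin|B_inf] := pselect (finite_set B).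
  apply: finite_lt_infinite => //; rewrite finite_setU; split=> //.
  exact: card_le_finite AB B_fin.
by apply: card_le_lt_trans BX; exact: card_setU_le.
Qed.

(** * Cofinality and successor cardinals *)

Definition cofinality_gt d (W : orderType d) X (A : set X) : Prop :=
  forall F : set W, cofinal F -> A #< F.

Definition is_regular d (W : orderType d) : Prop :=
  forall u : W, cofinality_gt W [set t | t < u].

Section Cofinality.
Context d (W : orderType d).

Lemma cofinality_gt_le X Y (A : set X) (B : set Y) :
  B #<= A -> cofinality_gt W A -> cofinality_gt W B.
Proof. by move=> BA cfA F cofF; exact: card_le_lt_trans BA (cfA F cofF). Qed.

Lemma cofinality_gt_card_lt X (A : set X) : cofinality_gt W A -> A #< [set: W].
Proof. by apply; move=> w; exists w. Qed.

Lemma cofinality_gt_neq0 X (A : set X) : cofinality_gt W A -> [set: W] !=set0.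
Proof.
move=> /cofinality_gt_card_lt; rewrite card_ltNge => nWA; apply/set0P.
by apply: contra nWA => /eqP->; exact: card_ge0.
Qed.

Lemma cofinality_gt_bounded_set X (A : set X) (F : set W) :
  cofinality_gt W A -> F #<= A -> exists w, forall v, F v -> v < w.
Proof.
move=> cfA; rewrite card_leNgt; apply: contraNP => /forallNP Funb.
apply: cfA => w.
have /existsNP[v /not_implyP[Fv /negP]] := Funb w.
by rewrite -leNgt => wv; exists v.
Qed.

Lemma cofinality_gt_bounded X (A : set X) (f : X -> W) :
  cofinality_gt W A -> exists w, forall x, A x -> f x < w.
Proof.
move=> cfA; have [w wP] := cofinality_gt_bounded_set cfA (card_image_le f A).
by exists w => x Ax; apply: wP; exists x.
Qed.

Lemma cofinality_gt_setX X Y (A : set X) (B : set Y) :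
  cofinality_gt W A -> cofinality_gt W B -> cofinality_gt W (A `*` B).
Proof.
move=> cfA cfB F cofF; rewrite card_ltNge; apply/negP => /pfcard_geP[F0|].
  by have := cfA F cofF; rewrite F0 card_ltNge card_ge0.
move=> /surjfunPex[f FE].
have /choice[g gP] : forall a, exists w, forall b, B b -> f (a, b) < w.
  by move=> a; exact: cofinality_gt_bounded.
have [w wP] := cofinality_gt_bounded g cfA.
have [y] := cofF w; rewrite FE leNgt => -[[a b] [Aa Bb] <-] /negP; apply.
exact: lt_trans (gP a b Bb) (wP a Aa).
Qed.

Lemma cofinal_fiber dT (T : orderType dT) (f : W -> T) :
  cofinality_gt W [set: T] -> exists j, cofinal [set a | f a <= j].
Proof.
move=> cfW_T; apply: contrapT => /forallNP no_fiber.
have /choice[u uP] : forall j, exists u, forall a, f a <= j -> a < u.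
  move=> j; have /existsNP[u /forall2NP uP] := no_fiber j.
  by exists u => a fa; rewrite ltNge; have [//|/negP] := uP a.
have [v vP] := cofinality_gt_bounded u cfW_T.
have := uP (f v) v (lexx _); rewrite ltNge => /negP; apply.
exact/ltW/vP.
Qed.

Lemma cofinality_gt_nomax X (A : set X) :
  A !=set0 -> cofinality_gt W A -> forall w : W, exists v, w < v.
Proof.
move=> [a Aa] cfA w; have [v vP] := cofinality_gt_bounded (fun=> w) cfA.
by exists v; exact: vP Aa.
Qed.

Lemma nomax_infinite (w0 : W) :
  (forall w : W, exists v, w < v) -> infinite_set [set: W].
Proof.
move=> /choice[next next_gt]; apply/infiniteP.
have iter_mono : {homo (fun n => iter n next w0) : m n / (m < n)%N >-> m < n}.
  by apply: homo_ltn => [? ? ?|n]; [exact: lt_trans|exact: next_gt].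
apply: (@card_le_inj _ _ _ _ (fun n => iter n next w0)) => // m n _ _ mn.
by case: (ltngtP m n) => // /iter_mono; rewrite mn ltxx.
Qed.

Lemma cofinality_gt_card X (B : set X) :
  infinite_set B -> B #< [set: W] -> (forall w : W, [set a | a < w] #<= B) ->
  cofinality_gt W B.
Proof.
move=> B_inf; rewrite card_ltNge => /negP WB segB F cofF.
rewrite card_ltNge; apply/negP => FB; apply: WB.
have -> : [set: W] = \bigcup_(v in F) ([set a | a < v] `|` [set v]).
  apply/seteqP; split=> // a _; have [v Fv av] := cofF a; exists v => //.
  by move: av; rewrite le_eqVlt => /orP[/eqP|]; [right|left].
apply: card_bigcup_le => // v _; apply: card_setU_le => //.
exact/card_ltW/(finite_lt_infinite (finite_set1 v) B_inf).
Qed.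

End Cofinality.

Section Segment.
Context d (W : orderType d) (b : W).

Definition segment : Type := {a : W | a \in [set c | c < b]}.

HB.instance Definition _ := SubChoice.on segment.
HB.instance Definition _ := [SubChoice_isSubOrder of segment by <: with d].

Lemma segment_ordinal : is_ordinal W -> is_ordinal segment.
Proof.
move=> W_ord s; move: {2}(val s) (erefl (val s)) => a.
elim/(well_founded_ind W_ord): a s => a IH s sE.
by constructor=> t ts; apply: (IH (val t)) => //; rewrite -sE.
Qed.

Lemma card_segment : [set: segment] #= [set a | a < b].
Proof. exact: card_setT. Qed.

Lemma card_segment_lt : is_cardinal W -> [set: segment] #< [set: W].
Proof.
move=> [_ cardW]; rewrite card_ltNge (card_le_eqr card_segment) -card_ltNge.
exact: cardW.
Qed.

End Segment.

Section Successor.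
Context dL (L : orderType dL) dM (M : orderType dM).
Hypotheses (L_succ : is_successor_cardinal L M) (M_inf : infinite_set [set: M]).

Lemma successor_card_segment (w : L) : [set a | a < w] #<= [set: M].
Proof.
have [[_ cardL] _ L_least] := L_succ.
rewrite card_leNgt; apply/negP => /L_least; apply/negP.
by rewrite -card_ltNge; exact: cardL.
Qed.

Lemma successor_cofinality_gt : cofinality_gt L [set: M].
Proof.
by have [_ ML _] := L_succ; exact: cofinality_gt_card successor_card_segment.
Qed.

Lemma successor_regular : is_regular L.
Proof.
move=> w; apply: cofinality_gt_le successor_cofinality_gt.
exact: successor_card_segment.
Qed.

Lemma successor_infinite : infinite_set [set: L].
Proof.
by have [_ /card_ltW ML _] := L_succ; exact: card_le_infinite M_inf ML.
Qed.

End Successor.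

Lemma cofinality_neq0 dM (M : orderType dM) dT (T : orderType dT) :
  is_cofinality T M -> [set: M] !=set0 -> [set: T] !=set0.
Proof.
move=> [_ [A cofA AT] _] [m _]; have [a Aa _] := cofA m.
apply/set0P; apply: contraTN AT => /eqP->; rewrite card_eq0.
by apply/set0P; exists a.
Qed.

(* A singular cardinal is a limit cardinal, because successors are regular. *)
Lemma singular_successor_below dM (M : orderType dM) dT (T : orderType dT)
    dB (B : orderType dB) :
  is_cardinal M -> is_cofinality T M -> [set: T] #< [set: M] ->
  infinite_set [set: B] -> [set: B] #< [set: M] ->
  exists b : M, is_successor_cardinal (segment b) B.
Proof.
move=> [M_ord _] [_ [A cofA AT] _] TM B_inf BM.
have [b Bb b_least] : exists2 b : M, [set: B] #< [set c | c < b] &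
    forall a, [set: B] #< [set c | c < a] -> b <= a.
  apply: ordinal_least => //; apply: contrapT => /forallNP nB.
  have segB (w : M) : [set c | c < w] #<= [set: B].
    by rewrite card_leNgt; apply/negP; exact: nB.
  have BA : [set: B] #< A by exact: cofinality_gt_card cofA.
  suff : [set: M] #<= A by rewrite (card_le_eqr AT) card_leNgt TM.
  apply: ordinal_card_le => // w; apply/negP; rewrite -card_ltNge.
  exact: card_le_lt_trans (segB w) BA.
have segB (s : segment b) : [set t | t < s] #<= [set: B].
  have sb : val s < b by have := valP s; rewrite inE.
  have le_s : [set c | c < val s] #<= [set: B].
    by rewrite card_leNgt; apply: contraL sb => /b_least; rewrite -leNgt.
  apply: card_le_trans le_s.
  by apply: (@card_le_inj _ _ _ _ val) => // t u _ _ /val_inj.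
have Bseg : [set: B] #< [set: segment b].
  by rewrite card_ltNge (card_le_eql (card_segment b)) -card_ltNge.
have b_ord : is_ordinal (segment b) by exact: segment_ordinal.
exists b; split=> [|//|U C BC].
  by split=> // s; exact: card_le_lt_trans Bseg.
apply: ordinal_card_le => // s; apply/negP; rewrite -card_ltNge.
exact: card_le_lt_trans (segB s) BC.
Qed.

Lemma singular_three_successors_below dM (M : orderType dM)
    dT (T : orderType dT) dB (B : orderType dB) :
  is_cardinal M -> is_cofinality T M -> [set: T] #< [set: M] ->
  infinite_set [set: B] -> [set: B] #< [set: M] ->
  exists n i r : M, [/\ is_successor_cardinal (segment n) B,
    is_successor_cardinal (segment i) (segment n) &
    is_successor_cardinal (segment r) (segment i)].
Proof.
move=> cardM cfM TM B_inf BM; have segM (b : M) := card_segment_lt b cardM.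
have [n n_succ] := singular_successor_below cardM cfM TM B_inf BM.
have n_inf := successor_infinite n_succ B_inf.
have [i i_succ] := singular_successor_below cardM cfM TM n_inf (segM n).
have i_inf := successor_infinite i_succ n_inf.
have [r r_succ] := singular_successor_below cardM cfM TM i_inf (segM i).
by exists n, i, r.
Qed.

(** * Club guessing *)

Section ClosurePoints.
Context d (W : orderType d).
Hypothesis W_ord : is_ordinal W.

Definition is_strict_sup (A : set W) (s : W) : Prop :=
  (forall a, A a -> a < s) /\ (forall v, v < s -> exists2 a, A a & v <= a).

Lemma strict_sup_exists (A : set W) :
  (exists w, forall a, A a -> a < w) -> exists s, is_strict_sup A s.
Proof.
move=> /(ordinal_least W_ord)[s sA s_least]; exists s; split=> // v vs.
apply: contrapT => /forall2NP nv; move: vs; rewrite ltNge => /negP; apply.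
apply: s_least => a Aa; rewrite ltNge; apply/negP.
by have [] := nv a.
Qed.

Lemma strict_sup_unique (A : set W) s s' :
  is_strict_sup A s -> is_strict_sup A s' -> s = s'.
Proof.
wlog ss' : s s' / s < s'.
  by move=> lt_eq As As'; case: (ltgtP s s') => // ?; [|symmetry]; exact: lt_eq.
move=> [A_lt _] [_ /(_ s ss')[a /A_lt as_ sa]].
by move: as_; rewrite ltNge sa.
Qed.

Lemma image_strict_sup_exists X (A : set X) (f : X -> W) :
  cofinality_gt W A -> exists s, is_strict_sup (f @` A) s.
Proof.
move=> cfA; apply: strict_sup_exists.
exact: cofinality_gt_bounded_set cfA (card_image_le f A).
Qed.

Definition closure_points (g : W -> W) : set W :=
  [set s | forall t, t < s -> g t < s].

Lemma closure_points_bigcap_unbounded T (A : set T) (g : T -> W -> W) :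
  cofinality_gt W A -> cofinality_gt W [set: nat] -> is_regular W ->
  forall s0, exists2 s, s0 < s & (\bigcap_(i in A) closure_points (g i)) s.
Proof.
move=> cfA cf_nat regW s0.
have nomax := cofinality_gt_nomax (ex_intro _ 0%N I) cf_nat.
have /choice[h hP] : forall u : W,
    exists v, forall t i, t <= u -> A i -> g i t < v.
  move=> u; have [u' uu'] := nomax u.
  have [v vP] := cofinality_gt_bounded (fun p => g p.2 p.1)
    (cofinality_gt_setX (regW u') cfA).
  exists v => t i tu Ai; apply: (vP (t, i)); split=> //=.
  exact: le_lt_trans uu'.
pose u n := iter n h s0.
have [s [u_lt u_cof]] := image_strict_sup_exists u cf_nat.
exists s; first by apply: u_lt; exists 0%N.
move=> i Ai t /u_cof[_ [n _ <-] tn]; apply: lt_trans (hP _ _ _ tn Ai) _.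
by apply: u_lt; exists n.+1.
Qed.

Definition is_last_below (E : set W) (w p : W) : Prop :=
  [/\ E p, p <= w & forall e, E e -> e <= w -> e <= p].

Definition last_below (E : set W) (w : W) : W :=
  xget w [set p | is_last_below E w p].

(* Closure points form a closed set containing the least element. *)
Lemma last_below_closure_points T (A : set T) (g : T -> W -> W) w :
  let E := \bigcap_(i in A) closure_points (g i) in
  is_last_below E w (last_below E w).
Proof.
move=> E; apply: (xgetPex w (P := [set p | is_last_below E w p])).
have [p p_ub p_least] :=
  ordinal_least (A := [set p | forall e, E e -> e <= w -> e <= p]) W_ord
    (ex_intro _ w (fun e _ => id)).
exists p; split=> //; last by apply: p_least => e.
move=> i Ai t tp.
have [e [Ee ew te]] : exists e, [/\ E e, e <= w & t < e].
  apply: contrapT => ne; move: tp; rewrite ltNge => /negP; apply.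
  apply: p_least => e Ee ew; rewrite leNgt; apply/negP => te.
  by apply: ne; exists e.
exact: lt_le_trans (Ee i Ai t te) (p_ub e Ee ew).
Qed.

Lemma closure_point_limit (h : W -> W) s :
  (forall t, t < h t) -> (exists r, r < s) -> closure_points h s -> is_limit s.
Proof.
move=> h_gt s_gt s_cl; split=> // t ts.
by exists (h t); [exact: h_gt|exact: s_cl].
Qed.

Lemma unbounded_increasing_sequence dN (N : orderType dN) (w0 : W) (E : set W) :
  is_ordinal N -> cofinality_gt W [set: N] ->
  (forall w, exists2 s, w < s & E s) ->
  exists e : N -> W, range e `<=` E /\ {homo e : m n / m < n}.
Proof.
move=> N_ord cfN E_unb.
have [e eP] : exists e : N -> W,
    forall n, E (e n) /\ forall m, m < n -> e m < e n.
  apply: (wf_choice_recursion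
    (P := fun n e v => E v /\ forall m, m < n -> e m < v) w0 N_ord).
    by move=> n e e' v ee' [Ev ev]; split=> // m mn; rewrite -ee' //; exact: ev.
  move=> n e _; have [w wP] := cofinality_gt_bounded e cfN.
  have [s ws Es] := E_unb w; exists s; split=> // m _.
  exact: lt_trans (wP m I) ws.
exists e; split=> [_ [n _ <-]|m n]; first by have [] := eP n.
by have [_] := eP n; apply.
Qed.

End ClosurePoints.

Section ClubGuessing.
Context d (W : orderType d) dN (N : orderType dN) dI (I : orderType dI).
Hypotheses (W_ord : is_ordinal W) (N_ord : is_ordinal N) (I_ord : is_ordinal I).
Implicit Types (g : I -> W -> W) (w : W) (i k : I) (m n : N).

Definition guesses (c : N -> W) (h : W -> W) : Prop :=
  [/\ {homo c : m n / m <= n}, range c `<=` closure_points h &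
      forall n, exists m, c n < c m].

Definition is_ladder w (a : N -> W) : Prop :=
  [/\ {homo a : m n / m <= n}, forall n, a n < w &
      forall t, t < w -> exists n, t <= a n].

Definition ladder w : N -> W := xget (fun=> w) [set a | is_ladder w a].

Definition earlier_closure_points g i : set W :=
  \bigcap_(k in [set k | k < i]) closure_points (g k).

Definition candidate g i w n : W :=
  last_below (earlier_closure_points g i) (ladder w n).

Lemma candidate_is_last_below g i w n :
  is_last_below (earlier_closure_points g i) (ladder w n) (candidate g i w n).
Proof. exact: last_below_closure_points. Qed.

Lemma candidate_anti g w n :
  {homo (fun i => candidate g i w n) : i k / i <= k >-> k <= i}.
Proof.
move=> i k ik.
have [candidate_k candidate_le _] := candidate_is_last_below g k w n.
have [_ _] := candidate_is_last_below g i w n.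
by apply=> // l li; apply: candidate_k; exact: lt_le_trans ik.
Qed.

Lemma candidate_mono g i w :
  is_ladder w (ladder w) -> {homo candidate g i w : m n / m <= n}.
Proof.
move=> [ladder_mono _ _] m n mn.
have [candidate_m candidate_le _] := candidate_is_last_below g i w m.
have [_ _] := candidate_is_last_below g i w n.
by apply=> //; apply: le_trans candidate_le _; exact: ladder_mono.
Qed.

Lemma ladder_at_sup w (e : N -> W) :
  {homo e : m n / m < n} -> is_strict_sup (range e) w -> is_ladder w (ladder w).
Proof.
move=> e_mono [e_lt e_cof].
apply: (xgetPex _ (P := [set a | is_ladder w a])); exists e; split.
- exact: ltW_homo.
- by move=> n; apply: e_lt; exists n.
- by move=> t /e_cof[_ [n _ <-] tn]; exists n.
Qed.

Lemma refuting_family_exists : exists g, forall i h,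
  (forall w, ~ guesses (candidate g i w) h) ->
  forall w, ~ guesses (candidate g i w) (g i).
Proof.
apply: (wf_choice_recursion (P := fun i g h' => forall h,
    (forall w, ~ guesses (candidate g i w) h) ->
    forall w, ~ guesses (candidate g i w) h') id I_ord) => [i g g' h gg'|i g _].
  suff -> : candidate g i = candidate g' i by [].
  rewrite /candidate.
  suff -> : earlier_closure_points g i = earlier_closure_points g' i by [].
  by apply: eq_bigcapr => k ki; rewrite gg'.
have [[h hP]|nh] := pselect (exists h, forall w, ~ guesses (candidate g i w) h).
  by exists h.
by exists id => h hP; case: nh; exists h.
Qed.

Hypotheses (cfW_I : cofinality_gt W [set: I]).
Hypotheses (cfI_N : cofinality_gt I [set: N]) (regW : is_regular W).
Hypotheses (n0 : N) (N_nomax : forall n, exists m, n < m).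

(* For w a limit of common closure points, candidate g i w n decreases with i
   and so is constant from some i on. An i beyond this point for all n makes it
   equal to a later candidate, which lies in closure_points (g i). *)
Lemma candidate_guesses g : exists w i, guesses (candidate g i w) (g i).
Proof.
have N_inf : infinite_set [set: N] by exact: nomax_infinite.
have cfW_N : cofinality_gt W [set: N].
  exact: cofinality_gt_le (card_ltW (cofinality_gt_card_lt cfI_N)) cfW_I.
have cfW_nat : cofinality_gt W [set: nat].
  by apply: cofinality_gt_le cfW_N; exact/infiniteP.
have E_unb := closure_points_bigcap_unbounded W_ord g cfW_I cfW_nat regW.
have [w0 _] := cofinality_gt_neq0 cfW_I.
have [i0 _] := cofinality_gt_neq0 cfI_N.
have [e [e_E e_mono]] := unbounded_increasing_sequence w0 N_ord cfW_N E_unb.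
have [w w_sup] := image_strict_sup_exists W_ord e cfW_N.
have w_ladder := ladder_at_sup e_mono w_sup.
have [[_ l_lt l_cof] [e_lt e_cof]] := (w_ladder, w_sup).
have /choice[st stP] : forall n, exists i, forall k, i <= k ->
    candidate g k w n = candidate g i w n.
  move=> n; apply: (nonincreasing_ordinal_stationary i0 W_ord).
  exact: candidate_anti.
have [i iP] := cofinality_gt_bounded st cfI_N.
exists w, i; split=> [|_ [n _ <-]|n].
- exact: candidate_mono.
- have [j ij] := cofinality_gt_nomax (ex_intro _ n Logic.I) cfI_N i.
  have st_le : st n <= i by exact/ltW/iP.
  rewrite (stP n i) // -(stP n j); last exact: le_trans (ltW ij).
  have [candidate_j _ _] := candidate_is_last_below g j w n.
  exact: candidate_j.
- have [_ candidate_le _] := candidate_is_last_below g i w n.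
  have /e_cof[_ [k _ <-] ladder_le] := l_lt n.
  have [k' kk'] := N_nomax k; have [|m le_ladder] := l_cof (e k').
    by apply: e_lt; exists k'.
  exists m; apply: le_lt_trans (le_trans candidate_le ladder_le) _.
  apply: lt_le_trans (e_mono _ _ kk') _.
  have [_ _] := candidate_is_last_below g i w m.
  by apply=> // l _; apply: (e_E (e k')).
Qed.

Theorem club_guessing :
  exists c : W -> I -> N -> W, forall h, exists w i, guesses (c w i) h.
Proof.
have [g gP] := refuting_family_exists; exists (fun w i => candidate g i w) => h.
apply: contrapT => /forallNP none; have [w [i]] := candidate_guesses g.
by apply: (gP i h) => w' hit; apply: (none w'); exists i.
Qed.

End ClubGuessing.

(** * Normal functions and running suprema *)

Section NormalFunctions.
Context dR (R : orderType dR) dL (L : orderType dL).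

Definition is_normal (p : R -> L) : Prop :=
  {homo p : s t / s < t} /\
  forall s v, is_limit s -> v < p s -> exists2 t, t < s & v < p t.

Lemma club_in_normal (p : R -> L) (b : L) (C : set L) :
  is_normal p -> (forall s, p s < b) ->
  (forall v, v < b -> exists s, v < p s) -> club_in C b ->
  exists h : R -> R,
    forall s, closure_points h s -> (exists r, r < s) -> C (p s).
Proof.
move=> [p_mono p_cont] p_lt p_cof [_ C_unb C_closed].
have /choice[h hP] : forall t, exists s, exists2 q, C q & p t <= q /\ q < p s.
  move=> t; have [q Cq [tq qb]] := C_unb _ (p_lt t).
  by have [s qs] := p_cof q qb; exists s, q.
have h_gt t : t < h t.
  have [q _ [tq qh]] := hP t.
  have := le_lt_trans tq qh; apply: contraLR; rewrite -!leNgt.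
  exact: ltW_homo.
exists h => s s_cl s_gt; have s_lim := closure_point_limit h_gt s_gt s_cl.
apply: C_closed => [||v vs]; first exact: p_lt.
  split=> [|v vs]; first by have [r rs] := s_gt; exists (p r); exact: p_mono.
  by have [t ts vt] := p_cont s v s_lim vs; exists (p t) => //; exact: p_mono.
have [t ts vt] := p_cont s v s_lim vs; have [q Cq [tq qh]] := hP t.
exists q => //; split; first exact: le_trans (ltW vt) tq.
exact/(lt_trans qh)/p_mono/s_cl.
Qed.

Hypotheses (L_ord : is_ordinal L) (cfL_R : cofinality_gt L [set: R]).
Implicit Type z : R -> L.

Definition running_sup z (s : R) : L :=
  xget (z s) [set u | is_strict_sup (z @` [set t | t < s]) u].

Lemma running_supP z s : is_strict_sup (z @` [set t | t < s]) (running_sup z s).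
Proof.
apply: (xgetPex _ (P := [set u | is_strict_sup (z @` [set t | t < s]) u])).
apply: image_strict_sup_exists => //.
exact: cofinality_gt_le (card_leT _) cfL_R.
Qed.

Lemma lt_running_sup z t s : t < s -> z t < running_sup z s.
Proof. by move=> ts; have [+ _] := running_supP z s; apply; exists t. Qed.

Lemma running_sup_lt z s v : v < running_sup z s -> exists2 t, t < s & v <= z t.
Proof.
by move=> vs; have [_ /(_ v vs)[_ [t ts <-] vt]] := running_supP z s; exists t.
Qed.

Lemma eq_running_sup z z' s : (forall t, t < s -> z t = z' t) ->
  forall s', s' <= s -> running_sup z s' = running_sup z' s'.
Proof.
move=> zz' s' ss'; have := running_supP z s'.
have -> : z @` [set t | t < s'] = z' @` [set t | t < s'].
  by apply: eq_imagel => t /= ts'; apply: zz'; exact: lt_le_trans ss'.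
by move=> /strict_sup_unique; apply; exact: running_supP.
Qed.

Lemma running_sup_normal z :
  (forall s, running_sup z s <= z s) -> is_normal (running_sup z).
Proof.
move=> z_ge; split=> [s t st|s v [_ s_lim] vs].
  exact: le_lt_trans (z_ge s) (lt_running_sup z st).
have [t ts vt] := running_sup_lt vs; have [t' tt' t's] := s_lim t ts.
by exists t' => //; exact: le_lt_trans vt (lt_running_sup z tt').
Qed.

End NormalFunctions.

(** * Sequences increasing modulo bounded *)

Section EventualInclusion.
Context dT (T : orderType dT) (Y : Type).
Implicit Types F G H : T -> set Y.

Definition eventually_sub F G : Prop :=
  exists i, forall j, i <= j -> F j `<=` G j.

Lemma eventually_sub_trans G F H :
  eventually_sub F G -> eventually_sub G H -> eventually_sub F H.
Proof.
move=> [i FG] [k GH]; exists (Order.max i k) => j.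
by rewrite ge_max => /andP[/FG + /GH]; exact: subset_trans.
Qed.

Lemma bigcup_initial_segment dN (N : orderType dN) (H : N -> T -> set Y)
    (x : set Y) :
  cofinality_gt N (x `*` [set: T]) -> (forall k j, H k j `<=` x) ->
  exists n, forall j,
    \bigcup_k H k j `<=` \bigcup_(k in [set k | k <= n]) H k j.
Proof.
move=> cfN Hx; have [n0 _] := cofinality_gt_neq0 cfN.
pose first yj := xget n0 [set k | H k yj.2 yj.1].
have [n nP] := cofinality_gt_bounded first cfN.
exists n => j y [k _ Hk]; exists (first (y, j)).
  by apply/ltW/nP; split=> //; exact: Hx Hk.
by apply: (xgetPex n0 (P := [set k | H k j y])); exists k.
Qed.

End EventualInclusion.

Section EventuallyIncreasing.
Context dT (T : orderType dT) dL (L : orderType dL) (Y : Type).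
Variables (F : L -> T -> set Y) (x : set Y).
Hypothesis F_mono : forall b g, b <= g -> eventually_sub (F b) (F g).
Hypothesis F_sub : forall b j, F b j `<=` x.
Hypothesis F_club : forall b, is_limit b ->
  exists i, exists2 C, club_in C b &
    forall a j, C a -> i <= j -> F a j `<=` F b j.

Context dN (N : orderType dN) dR (R : orderType dR).
Hypotheses (L_ord : is_ordinal L) (R_ord : is_ordinal R).
Hypothesis cfL_R : cofinality_gt L [set: R].
Implicit Types (z : R -> L) (c : N -> R).

Definition union_upto z c (n : N) (j : T) : set Y :=
  \bigcup_(k in [set k | k <= n]) F (running_sup z (c k)) j.

Definition anticipates (Q : Type) (c : Q -> N -> R) z (s : R) (v : L) : Prop :=
  forall q n, (forall k, k <= n -> c q k <= s) ->
    (exists b, eventually_sub (union_upto z (c q) n) (F b)) ->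
    eventually_sub (union_upto z (c q) n) (F v).

Definition admissible (Q : Type) (c : Q -> N -> R) z (s : R) (v : L) : Prop :=
  [/\ running_sup z s <= v, ~ eventually_sub (F v) (F (running_sup z s)) &
      anticipates c z s v].

Lemma admissible_local Q (c : Q -> N -> R) z z' s v :
  (forall t, t < s -> z t = z' t) -> admissible c z s v -> admissible c z' s v.
Proof.
move=> /eq_running_sup zz' [le_v nsub antic]; split; rewrite -?zz' //.
move=> q n cs.
suff -> : union_upto z' (c q) n = union_upto z (c q) n by exact: antic.
by apply/funext => j; apply: eq_bigcupr => k kn; rewrite zz' //; exact: cs.
Qed.

Lemma admissible_exists Q (c : Q -> N -> R) z s :
  cofinality_gt L ([set: Q] `*` [set: N]) ->
  (forall b, exists2 g, b <= g & ~ eventually_sub (F g) (F b)) ->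
  exists v, admissible c z s v.
Proof.
move=> cfL_QN grow.
pose bounds qn := [set b | eventually_sub (union_upto z (c qn.1) qn.2) (F b)].
pose bound qn := xget (running_sup z s) (bounds qn).
have [b bP] := cofinality_gt_bounded bound cfL_QN.
have [v] := grow (Order.max b (running_sup z s)).
rewrite ge_max => /andP[bv sv] nsub; exists v; split=> // [sub|q n _ ex].
  apply: nsub; apply: eventually_sub_trans sub (F_mono _).
  by rewrite le_max lexx orbT.
apply: (@eventually_sub_trans _ _ _ (F (bound (q, n)))).
  exact: (xgetPex _ (P := bounds (q, n))).
by apply: F_mono; apply: le_trans bv; apply: ltW; exact: bP.
Qed.

Lemma running_sup_bounded_at_closure_points z (r0 : R) :
  (forall s : R, exists t, s < t) ->
  (forall s, running_sup z s <= z s) ->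
  exists (h : R -> R) b i, forall s j, closure_points h s -> i <= j ->
    F (running_sup z s) j `<=` F b j.
Proof.
move=> R_nomax z_ge.
have [b [z_lt z_cof]] := image_strict_sup_exists L_ord z cfL_R.
have sup_normal := running_sup_normal L_ord cfL_R z_ge.
have sup_lt s : running_sup z s < b.
  by apply: le_lt_trans (z_ge s) (z_lt _ _); exists s.
have sup_cof v : v < b -> exists s, v < running_sup z s.
  move=> /z_cof[_ [s _ <-] vs]; have [t st] := R_nomax s.
  by exists t; exact: le_lt_trans vs (lt_running_sup L_ord cfL_R z st).
have b_lim : is_limit b.
  split=> [|v /sup_cof[s vs]]; first by exists (running_sup z r0).
  by exists (running_sup z s).
have [i [C C_club C_sub]] := F_club b_lim.
have [h hP] := club_in_normal sup_normal sup_lt sup_cof C_club.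
(* The least r is a closure point of h, but not a limit. *)
have [r _ r_min] := ordinal_least R_ord (ex_intro setT r0 Logic.I).
have [i' r_sub] := F_mono (ltW (sup_lt r)).
exists h, b, (Order.max i i') => s j s_cl; rewrite ge_max => /andP[ij i'j].
have := r_min s Logic.I; rewrite le_eqVlt => /orP[/eqP<-|rs].
  exact: r_sub.
by apply: C_sub ij; apply: hP s_cl _; exists r.
Qed.

Lemma anticipated_sequence_unbounded Q (c : Q -> N -> R) z q :
  cofinality_gt N (x `*` [set: T]) -> (forall s, admissible c z s (z s)) ->
  {homo c q : m n / m <= n} -> (forall n, exists m, c q n < c q m) ->
  ~ exists b i, forall k j, i <= j -> F (running_sup z (c q k)) j `<=` F b j.
Proof.
move=> cfN z_adm c_mono c_grow [b [i sub]].
have [n nP] := bigcup_initial_segment cfN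
  (fun k => @F_sub (running_sup z (c q k))).
have union_sub : eventually_sub (union_upto z (c q) n) (F b).
  by exists i => j ij; apply: bigcup_sub => k _; exact: sub.
have [m1 nm1] := c_grow n; have [m2 m12] := c_grow m1.
have [m3 m23] := c_grow m2.
have z_lt_sup s t : s < t -> eventually_sub (F (z s)) (F (running_sup z t)).
  by move=> st; apply/F_mono/ltW; exact: lt_running_sup.
have [_ + _] := z_adm (c q m2); apply.
apply: eventually_sub_trans (z_lt_sup _ _ m23) _.
apply: (@eventually_sub_trans _ _ _ (union_upto z (c q) n)).
  by exists i => j _ y Fy; apply: nP; exists m3.
have [_ _ antic] := z_adm (c q m1).
apply: eventually_sub_trans (z_lt_sup _ _ m12).
apply: antic; last by exists b.
by move=> k kn; apply: le_trans (ltW nm1); exact: c_mono.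
Qed.

Lemma admissible_sequence_exists Q (c : Q -> N -> R) :
  cofinality_gt L ([set: Q] `*` [set: N]) ->
  (forall b, exists2 g, b <= g & ~ eventually_sub (F g) (F b)) ->
  exists z, forall s, admissible c z s (z s).
Proof.
move=> cfL_QN grow; have [l0 _] := cofinality_gt_neq0 cfL_R.
apply: (wf_choice_recursion (P := fun s z v => admissible c z s v) l0 R_ord).
  by move=> s z z' v; exact: admissible_local.
by move=> s z _; exact: admissible_exists.
Qed.

Context dI (I : orderType dI).
Hypotheses (N_ord : is_ordinal N) (I_ord : is_ordinal I).
Hypotheses (cfI_N : cofinality_gt I [set: N]).
Hypotheses (cfR_I : cofinality_gt R [set: I]).
Hypotheses (R_regular : is_regular R) (T_neq0 : [set: T] !=set0).
Hypotheses (cfN_T : cofinality_gt N [set: T]) (cfN_x : cofinality_gt N x).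

Theorem eventually_increasing_stabilizes :
  exists b, forall g, b <= g -> eventually_sub (F g) (F b).
Proof.
have [n0 _] := cofinality_gt_neq0 cfN_T.
have [i0 _] := cofinality_gt_neq0 cfI_N.
have [r0 _] := cofinality_gt_neq0 cfR_I.
have N_nomax := cofinality_gt_nomax T_neq0 cfN_T.
have R_nomax := cofinality_gt_nomax (ex_intro _ i0 Logic.I) cfR_I.
have [c guessP] :=
  club_guessing R_ord N_ord I_ord cfR_I cfI_N R_regular n0 N_nomax.
have IleR := card_ltW (cofinality_gt_card_lt cfR_I).
have NleI := card_ltW (cofinality_gt_card_lt cfI_N).
have cfL_RIN : cofinality_gt L ([set: R * I] `*` [set: N]).
  rewrite -setXTT; apply: cofinality_gt_setX.
    by apply: cofinality_gt_setX => //; exact: cofinality_gt_le cfL_R.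
  exact: cofinality_gt_le (card_le_trans NleI IleR) cfL_R.
apply: contrapT => /forallNP nonstab.
have grow b : exists2 g, b <= g & ~ eventually_sub (F g) (F b).
  by have /existsNP[g /not_implyP[bg nsub]] := nonstab b; exists g.
pose c_pair q := c q.1 q.2.
have [z z_adm] := admissible_sequence_exists c_pair cfL_RIN grow.
have z_ge s : running_sup z s <= z s by case: (z_adm s).
have [h [b [i sub]]] := running_sup_bounded_at_closure_points r0 R_nomax z_ge.
have [w [k [c_mono c_cl c_grow]]] := guessP h.
apply: (@anticipated_sequence_unbounded _ c_pair z (w, k)) => //.
  exact: cofinality_gt_setX.
by exists b, i => l j; apply: sub; apply: c_cl; exists l.
Qed.

End EventuallyIncreasing.

(** * Coherent families on P_kappa X *)

Section Pkappa.
Variables K X : Type.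
Implicit Types x y : Pkappa K X.

Lemma le_PkappaE x y : (x <= y) = (val x `<=` val y) :> Prop.
Proof. by rewrite -subsetEset. Qed.

Lemma Pkappa_card_lt x : val x #< [set: K].
Proof. by have := valP x; rewrite inE. Qed.

Lemma cofinal_Pkappa_sup (G : set (Pkappa K X)) (z : set X) :
  cofinal G -> z #< [set: K] -> exists2 y, G y & z `<=` val y.
Proof.
move=> cofG zK; have [y Gy] := cofG (exist _ z (mem_set zK)).
by rewrite le_PkappaE => zy; exists y.
Qed.

End Pkappa.

Section CoherentFamilies.
Variables K X : Type.
Context dT (T : orderType dT).
Variable E : Pkappa K X -> T -> set X.
Hypotheses (K_inf : infinite_set [set: K]) (T_ord : is_ordinal T).
Implicit Types x y z : Pkappa K X.

Definition agree_from (i : T) x y : Prop :=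
  forall j, i <= j -> forall a, val x a -> (E x j a <-> E y j a).

Definition coherent : Prop := forall x y, x <= y -> exists i, agree_from i x y.

Lemma agree_from_le i k x y : i <= k -> agree_from i x y -> agree_from k x y.
Proof. by move=> ik xy j kj; apply: xy; exact: le_trans kj. Qed.

Lemma agree_from_trans i k x y z : x <= y ->
  agree_from i x y -> agree_from k y z -> agree_from (Order.max i k) x z.
Proof.
rewrite le_PkappaE => sub_xy xy yz j; rewrite ge_max => /andP[ij kj] a xa.
by rewrite xy // yz //; exact: sub_xy.
Qed.

Lemma agree_from_cancel i k x y z : x <= y ->
  agree_from i x z -> agree_from k y z -> agree_from (Order.max i k) x y.
Proof.
rewrite le_PkappaE => sub_xy xz yz j; rewrite ge_max => /andP[ij kj] a xa.
by rewrite xz // yz //; exact: sub_xy.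
Qed.

Lemma coherent_coloring : coherent ->
  exists c : pairs (Pkappa K X) -> T,
    subadditive c /\ forall p, agree_from (c p) (val p).1 (val p).2.
Proof.
move=> coh.
have /choice[c cP] : forall p : pairs (Pkappa K X), exists i,
    agree_from i (val p).1 (val p).2 /\
    forall k, agree_from k (val p).1 (val p).2 -> i <= k.
  move=> [[x y] /= /ltW /coh xy].
  by have [i ag i_min] := ordinal_least T_ord xy; exists i.
exists c; split=> [u v w uv vw uw|p]; last by have [] := cP p.
have [/= uvP uv_min] := cP (mkpair uv); have [/= vwP _] := cP (mkpair vw).
have [/= uwP uw_min] := cP (mkpair uw).
split; [apply: uw_min|apply: uv_min].
  exact: agree_from_trans (ltW uv) uvP vwP.
exact: agree_from_cancel (ltW uv) uwP vwP.
Qed.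

Lemma coherent_uniform_cofinal :
  (~ exists c : pairs (Pkappa K X) -> T,
       subadditive c /\ strongly_unbounded c) ->
  coherent ->
  exists G i, cofinal G /\ forall x y, G x -> G y -> x <= y -> agree_from i x y.
Proof.
move=> no_coloring /coherent_coloring[c [c_sub cP]].
apply: contrapT => no_uniform; apply: no_coloring.
exists c; split=> // G cofG i.
apply: contrapT => c_lt; apply: no_uniform; exists G, i; split=> // x y Gx Gy.
rewrite le_eqVlt => /orP[/eqP->//|xy].
apply: agree_from_le (cP (mkpair xy)); rewrite leNgt; apply/negP => ic.
by apply: c_lt; exists (c (mkpair xy)); [exists (mkpair xy)|exact: ltW].
Qed.

Lemma uniformly_coherent_glue G i :
  cofinal G -> (forall x y, G x -> G y -> x <= y -> agree_from i x y) ->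
  (forall x j k, j <= k -> E x j `<=` E x k) ->
  (forall x, val x `<=` \bigcup_j E x j) ->
  exists f : X -> T, forall y a j, G y -> val y a -> f a <= j -> E y j a.
Proof.
move=> cofG unif E_mono E_cover.
have /choice[x_ x_P] : forall a, exists x, G x /\ val x a.
  move=> a; have aK := finite_lt_infinite (finite_set1 a) K_inf.
  have [x Gx ax] := cofinal_Pkappa_sup cofG aK.
  by exists x; split=> //; exact: ax.
have /choice[f fP] : forall a, exists j, i <= j /\ E (x_ a) j a.
  move=> a; have [j _ Ej] := E_cover _ _ (x_P a).2.
  exists (Order.max i j); split; first by rewrite le_max lexx.
  by apply: E_mono Ej; rewrite le_max lexx orbT.
exists f => y a j Gy ya fj; have [Gx xa] := x_P a; have [i_f Ef] := fP a.
have xyK := card_lt_setU K_inf (Pkappa_card_lt (x_ a)) (Pkappa_card_lt y).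
have [z Gz] := cofinal_Pkappa_sup cofG xyK.
rewrite subUset -!le_PkappaE => -[xz yz].
have ij := le_trans i_f fj.
by rewrite (unif y z) // -(unif (x_ a) z) //; exact: E_mono Ef.
Qed.

End CoherentFamilies.

(** * Traces of a covering matrix *)

Section Traces.
Context dT (T : orderType dT) dL (L : orderType dL) (D : T -> L -> set L).
Hypotheses (D_cover : covering_matrix D) (D_trans : transitive_matrix D).
Hypothesis T_neq0 : [set: T] !=set0.

Definition trace (x : set L) (b : L) (j : T) : set L := D j b `&` x.

Lemma trace_mono x b g : b <= g -> eventually_sub (trace x b) (trace x g).
Proof.
have [D_mono D_cup _] := D_cover.
rewrite le_eqVlt => /orP[/eqP->|bg].
  by have [t _] := T_neq0; exists t => j _ a.
have [i _ Dib] : (\bigcup_i D i g) b by rewrite D_cup.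
exists i => j ij; apply: setSI; apply: D_trans => //; exact: D_mono Dib.
Qed.

Lemma trace_club x b : uniform_matrix D -> is_limit b ->
  exists i, exists2 C, club_in C b &
    forall a j, C a -> i <= j -> trace x a j `<=` trace x b j.
Proof.
have [D_mono _ _] := D_cover.
move=> D_unif /D_unif[i [C C_club CD]]; exists i, C => // a j Ca ij.
have [C_lt _ _] := C_club; apply: setSI; apply: D_trans; first exact: C_lt.
exact: D_mono ij _ (CD _ Ca).
Qed.

Lemma trace_stabilizes dK (K : orderType dK) dN (N : orderType dN)
    dI (I : orderType dI) dR (R : orderType dR) x :
  uniform_matrix D -> is_ordinal L -> infinite_set [set: K] ->
  is_successor_cardinal N K -> is_successor_cardinal I N ->
  is_successor_cardinal R I -> cofinality_gt L [set: R] ->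
  [set: T] #<= [set: K] -> x #<= [set: K] ->
  exists b, forall g, b <= g -> eventually_sub (trace x g) (trace x b).
Proof.
move=> D_unif L_ord K_inf NK IN RI cfL_R TK xK.
have N_inf := successor_infinite NK K_inf.
have I_inf := successor_infinite IN N_inf.
have [[N_ord _] _ _] := NK; have [[I_ord _] _ _] := IN.
have [[R_ord _] _ _] := RI.
have cfN_K := successor_cofinality_gt NK K_inf.
apply: (eventually_increasing_stabilizes (x := x) _ _ _
  L_ord R_ord cfL_R N_ord I_ord) => //.
- exact: trace_mono.
- by move=> b j; exact: subIsetr.
- by move=> b; exact: trace_club.
- exact: successor_cofinality_gt.
- exact: successor_cofinality_gt.
- exact: successor_regular I_inf.
- exact: cofinality_gt_le cfN_K.
- exact: cofinality_gt_le cfN_K.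
Qed.

Context (K : Type).
Hypotheses (K_inf : infinite_set [set: K]) (T_ord : is_ordinal T).
Hypotheses (T_lt_K : [set: T] #< [set: K]) (cfL_K : cofinality_gt L [set: K]).

Lemma stable_traces_coherent (b : Pkappa K L -> L) :
  (forall (x : Pkappa K L) g, b x <= g ->
     eventually_sub (trace (val x) g) (trace (val x) (b x))) ->
  coherent (fun x j => D j (b x)).
Proof.
move=> stable x y; rewrite le_PkappaE => xy; pose g := Order.max (b x) (b y).
have xg : b x <= g by rewrite le_max lexx.
have yg : b y <= g by rewrite le_max lexx orbT.
have [i1 g_to_x] := stable x g xg; have [i2 x_to_g] := trace_mono (val x) xg.
have [i3 g_to_y] := stable y g yg; have [i4 y_to_g] := trace_mono (val y) yg.
exists (Order.max (Order.max i1 i2) (Order.max i3 i4)) => j.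
rewrite !ge_max => /andP[/andP[j1 j2] /andP[j3 j4]] a xa; split=> Da.
- have [Dg _] := x_to_g j j2 a (conj Da xa).
  by have [] := g_to_y j j3 a (conj Dg (xy _ xa)).
- have [Dg _] := y_to_g j j4 a (conj Da (xy _ xa)).
  by have [] := g_to_x j j1 a (conj Dg xa).
Qed.

Theorem stable_traces_CP :
  (~ exists c : pairs (Pkappa K L) -> T,
       subadditive c /\ strongly_unbounded c) ->
  (forall x : Pkappa K L, exists b, forall g, b <= g ->
     eventually_sub (trace (val x) g) (trace (val x) b)) ->
  CP D.
Proof.
move=> no_coloring /choice[b' stable']; have [D_mono D_cup _] := D_cover.
have /choice[u uP] : forall x : Pkappa K L,
    exists u, forall a, val x a -> a < u.
  move=> x; apply: (cofinality_gt_bounded id).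
  exact: cofinality_gt_le (card_ltW (Pkappa_card_lt x)) cfL_K.
pose b (x : Pkappa K L) := Order.max (b' x) (u x).
have stable (x : Pkappa K L) g :
    b x <= g -> eventually_sub (trace (val x) g) (trace (val x) (b x)).
  rewrite ge_max => /andP[b'g _].
  apply: eventually_sub_trans (stable' x g b'g) _.
  by apply: trace_mono; rewrite le_max lexx.
have [G [i [cofG unif]]] :=
  coherent_uniform_cofinal T_ord no_coloring (stable_traces_coherent stable).
have [x j k|x a xa|f fP] := uniformly_coherent_glue K_inf cofG unif.
- exact: D_mono.
- by rewrite D_cup /= lt_max (uP x) ?orbT.
have cfL_T := cofinality_gt_le (card_ltW T_lt_K) cfL_K.
have [j cof_fiber] := cofinal_fiber f cfL_T.
exists [set a | f a <= j] => // Z Z_fiber ZT.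
have ZK : Z #< [set: K] by rewrite card_ltNge (card_le_eqr ZT) -card_ltNge.
have [y Gy Zy] := cofinal_Pkappa_sup cofG ZK.
by exists (b y), j => a Za; apply: fP => //; [exact: Zy|exact: Z_fiber].
Qed.

End Traces.

Theorem theorem4p4
    (dK : Order.disp_t) (kappa : orderType dK)
    (dM : Order.disp_t) (mu : orderType dM)
    (dT : Order.disp_t) (cf_mu : orderType dT)
    (dL : Order.disp_t) (mu_plus : orderType dL)
    (kappa_card : is_infinite_cardinal kappa)
    (mu_card : is_infinite_cardinal mu)
    (kappa_lt_mu : [set: kappa] #< [set: mu])
    (cf_muE : is_cofinality cf_mu mu)
    (mu_plusE : is_successor_cardinal mu_plus mu)
    (cf_mu_lt_kappa : [set: cf_mu] #< [set: kappa])
    (no_coloring : ~ exists c : pairs (Pkappa kappa mu_plus) -> cf_mu,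
        subadditive c /\ strongly_unbounded c) :
  forall D : cf_mu -> mu_plus -> set mu_plus,
    covering_matrix D -> transitive_matrix D -> uniform_matrix D -> CP D.
Proof.
move=> D D_cover D_trans D_unif.
have [_ kappa_inf] := kappa_card; have [mu_cardinal mu_inf] := mu_card.
have [[cf_mu_ord _] _ _] := cf_muE; have [[mu_plus_ord _] _ _] := mu_plusE.
have cf_mu_neq0 := cofinality_neq0 cf_muE (infinite_setN0 mu_inf).
have cf_mu_lt_mu := card_le_lt_trans (card_ltW cf_mu_lt_kappa) kappa_lt_mu.
have [n [i [r [n_succ i_succ r_succ]]]] :=
  singular_three_successors_below mu_cardinal cf_muE cf_mu_lt_mu
    kappa_inf kappa_lt_mu.
have mu_plus_cf := successor_cofinality_gt mu_plusE mu_inf.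
have mu_plus_cf_r : cofinality_gt mu_plus [set: segment r].
  exact: cofinality_gt_le (card_ltW (card_segment_lt r mu_cardinal)) mu_plus_cf.
apply: (stable_traces_CP D_cover D_trans cf_mu_neq0 kappa_inf) => // [|x].
  exact: cofinality_gt_le (card_ltW kappa_lt_mu) mu_plus_cf.
apply: trace_stabilizes n_succ i_succ r_succ mu_plus_cf_r _ _ => //.
  exact: card_ltW.
exact/card_ltW/Pkappa_card_lt.
Qed.
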